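(* Let $$G\cong C_{n_1}\oplus\cdots\oplus C_{n_r},\qquad n_1\mid n_2\mid\cdots\mid n_r,$$ where $n_1,\dots,n_r$ are positive integers and $|G|>1$, and let $e=n_r=\operatorname{exp}(G)$. For each positive divisor $d\mid e$, let $$a_G(d)=|\{x\in G:\operatorname{ord}(x)=d\}|.$$ Then $$a_G(d)=\sum_{c\mid d}\mu\!\left(\frac dc\right)\prod_{i=1}^r\gcd(c,n_i).$$ Consequently, $$\mathcal{C}(G)=\max\left\{m\in\mathbb{N}:\sum_{\substack{d\mid e\\ d>m}}a_G(d)\ge m\right\}.$$
   Context: $C_m$ denotes a cyclic group of order $m$; $\operatorname{exp}(G)$ is the exponent of $G$ (the least common multiple of the orders of its elements); $\operatorname{ord}(x)$ is the order of $x$; $\mu$ is the classical number-theoretic Möbius function. A nonempty subset $S$ of a finite group $G$ is called a Chowla set if $\operatorname{ord}(x)>|S|$ for every $x\in S$. Define $\mathcal{C}(G)=\max\{|S|:S\subseteq G\text{ is a Chowla set}\}$. *)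

(* Defs.v *)
From mathcomp Require Import all_boot all_order all_algebra all_fingroup all_solvable.

Set Implicit Arguments.
Unset Strict Implicit.
Unset Printing Implicit Defensive.

Import GRing.Theory.
Local Open Scope ring_scope.

(* [all ...] says that [n] is squarefree. *)
Definition moebius (n : nat) : int :=
  if (0 < n)%N && all (fun p => logn p n == 1%N) (primes n)
  then (-1) ^+ size (primes n) else 0.

Definition is_maximum (P : pred nat) (m : nat) : Prop :=
  P m /\ forall k : nat, P k -> (k <= m)%N.

(* C_(n_0) (+) ... (+) C_(n_(r-1)). [Zp m] is cyclic of order [m] for every
   positive [m], including [m = 1], where the type ['Z_1] has two elements. *)
Definition cyclic_sum (r : nat) (n : 'I_r -> nat) :
    {set {dffun forall i : 'I_r, 'Z_(n i)}} :=
  setXn (fun i : 'I_r => Zp (n i)).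

Section Chowla.
Variables (gT : finGroupType) (G : {set gT}).

Definition num_order (d : nat) : nat := #|[set x in G | #[x]%g == d]|.

Definition chowla_set (S : {set gT}) : bool :=
  [&& S != set0, S \subset G & [forall x in S, (#|S| < #[x]%g)%N]].

(* The value is 0 when [G] has no Chowla set, i.e. when [G] is trivial. *)
Definition chowla_number : nat := (\max_(S : {set gT} | chowla_set S) #|S|)%N.

End Chowla.

(* Main.v *)
Require Import Defs.
From mathcomp Require Import all_boot all_order all_algebra all_fingroup all_solvable.

(** Everything follows from counting, for each [c > 0], the solutions of
    [x ^+ c = 1] in [G], i.e. the set ['Ldiv_c(G)].

    A cyclic group of order [m] has exactly [gcdn c m] such solutions, namely
    its unique subgroup of that order, and in a direct product the equation is
    solved coordinate by coordinate. Hence [G] has [\prod_i gcdn c (n i)]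
    solutions ([card_Ldiv_cyclic_sum], carried to [G] by [card_Ldiv_isog]). On
    the other hand the solutions are the elements whose order divides [c], so
    the same number is the sum of [num_order G b] over the divisors [b] of [c]
    ([card_Ldiv_num_order]); [moebius_inversion] then gives the formula for
    [num_order G d].

    The count also determines the exponent: it divides [c] exactly when all of
    [G] solves the equation, and since [gcdn c (n i) <= n i] this forces
    [gcdn c (n i) = n i] for every [i] ([exponent_dvdn_cyclic_sum]). Along a
    divisibility chain this means that the last [n i] divides [c].

    For the Chowla number, a set of size [m > 0] is a Chowla set exactly when it
    lies in the set of elements of order greater than [m]; so one of size [m]
    exists as soon as that set has at least [m] elements. Sorting its elements
    by their order, a divisor of the exponent, turns its cardinality into the
    sum in the theorem ([chowla_number_maximum]). *)

(** * Moebius inversion over divisors *)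

Lemma moebius_prime_mul (p j : nat) :
  prime p -> 0 < j -> ~~ (p %| j) -> moebius (p * j) = (- moebius j)%R.
Proof.
move=> p_pr j_gt0 pNj; have p_gt0 := prime_gt0 p_pr.
have primes_pj : perm_eq (primes (p * j)) (p :: primes j).
  apply: uniq_perm; rewrite ?primes_uniq //=.
    by rewrite primes_uniq mem_primes (negPf pNj) !andbF.
  by move=> q; rewrite primesM // primes_prime // !inE.
rewrite /moebius muln_gt0 p_gt0 j_gt0 /= (perm_all _ primes_pj) /=.
rewrite (perm_size primes_pj) /= lognM // logn_prime // eqxx.
rewrite [logn p j]lognE p_pr j_gt0 (negPf pNj) /=.
rewrite (@eq_in_all _ _ (fun q => logn q j == 1)); last first.
  move=> q; rewrite mem_primes => /and3P[q_pr _ q_j].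
  rewrite lognM // logn_prime //.
  by case: (eqVneq q p) q_j => [->|_ _]; rewrite ?(negPf pNj).
by case: ifP => _; rewrite ?GRing.oppr0 // GRing.exprS GRing.mulN1r.
Qed.

Lemma moebius_square_dvd (p k : nat) :
  prime p -> p ^ 2 %| k -> moebius k = 0%R.
Proof.
move=> p_pr; rewrite /moebius; case: (posnP k) => [->//|k_gt0] p2k /=.
have lp : 1 < logn p k by rewrite -pfactor_dvdn.
have pk : p \in primes k by rewrite -logn_gt0 (ltn_trans _ lp).
by case: allP => // /(_ p pk) /eqP lp1; rewrite lp1 in lp.
Qed.

(** A prime [p] dividing [n] pairs off the divisors of [n] outside the multiples
    of [p ^ 2]: the map [j |-> p * j] is a bijection from those prime to [p] to
    the multiples of [p], and it changes the sign of [moebius]. *)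
Lemma sum_moebius_divisors (n : nat) :
  0 < n -> (\sum_(k <- divisors n) moebius k = (n == 1)%:R)%R.
Proof.
move=> n_gt0; case: (eqVneq n 1) => [->|n_neq1]; first by rewrite big_seq1.
have n_gt1 : 1 < n by rewrite ltn_neqAle eq_sym n_neq1.
pose p := pdiv n; have p_pr : prime p := pdiv_prime n_gt1.
have p_gt0 := prime_gt0 p_pr.
rewrite (bigID (fun k => p %| k)) /= (bigID (fun k => p ^ 2 %| k)) /=.
rewrite big1 => [|k /andP[_ /(moebius_square_dvd p k p_pr)]//].
rewrite GRing.add0r.
have toggle : perm_eq [seq p * j | j <- [seq j <- divisors n | ~~ (p %| j)]]
                 [seq k <- divisors n | p %| k & ~~ (p ^ 2 %| k)].
  apply: uniq_perm; rewrite ?filter_uniq ?divisors_uniq //.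
    rewrite map_inj_uniq ?filter_uniq ?divisors_uniq // => i j /eqP.
    by rewrite eqn_pmul2l // => /eqP.
  move=> k; apply/mapP/idP => [[j + ->]|].
    rewrite !mem_filter -!dvdn_divisors // => /andP[pNj j_n].
    rewrite dvdn_mulr //= expnS expn1 dvdn_pmul2l // pNj /=.
    by rewrite Gauss_dvd ?pdiv_dvd // prime_coprime.
  rewrite mem_filter -dvdn_divisors // => /andP[/andP[/dvdnP[j ->] ] ].
  rewrite expnS expn1 mulnC dvdn_pmul2l // => pNj pj_n.
  exists j => //; rewrite mem_filter pNj -dvdn_divisors //.
  exact: dvdn_trans (dvdn_mull _ _) pj_n.
rewrite -big_filter -(perm_big _ toggle) /= big_map big_filter big_seq_cond.
rewrite [X in (_ + X)%R]big_seq_cond -big_split /= big1 // => j.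
rewrite -dvdn_divisors // => /andP[j_n pNj].
by rewrite moebius_prime_mul ?GRing.addNr // (dvdn_gt0 n_gt0 j_n).
Qed.

Lemma codivisorK (d k : nat) : 0 < d -> k %| d -> d %/ (d %/ k) = k.
Proof. by move=> d_gt0 k_d; rewrite divnA // mulKn. Qed.

(** Reindexing that turns the inner sum of Moebius inversion, over the [c] with
    [b %| c %| d], into a sum of [moebius] over all divisors of [d %/ b]. *)
Lemma perm_codivisors {b d : nat} :
  0 < d -> b %| d ->
  perm_eq [seq d %/ c | c <- [seq c <- divisors d | b %| c]]
          (divisors (d %/ b)).
Proof.
move=> d_gt0 b_d; have b_gt0 := dvdn_gt0 d_gt0 b_d.
have db_gt0 : 0 < d %/ b by rewrite divn_gt0 // dvdn_leq.
apply: uniq_perm; rewrite ?divisors_uniq //.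
  rewrite map_inj_in_uniq ?filter_uniq ?divisors_uniq // => i j.
  rewrite !mem_filter -!dvdn_divisors // => /andP[_ i_d] /andP[_ j_d] eq_ij.
  by rewrite -(codivisorK d i) // eq_ij codivisorK.
move=> k; rewrite -dvdn_divisors //; apply/mapP/idP => [[c + ->]|k_db].
  rewrite mem_filter -dvdn_divisors // => /andP[/dvdnP[j ->] jb_d].
  rewrite -(dvdn_pmul2r b_gt0) divnK // -[X in _ %| X](divnK jb_d).
  by rewrite dvdn_mul // dvdn_mull.
have kb_d : k * b %| d by rewrite -(divnK b_d) dvdn_pmul2r.
have k_d : k %| d := dvdn_trans (dvdn_mulr b (dvdnn k)) kb_d.
exists (d %/ k); last by rewrite codivisorK.
rewrite mem_filter -dvdn_divisors // dvdn_div // andbT.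
by rewrite -(dvdn_pmul2r (dvdn_gt0 d_gt0 k_d)) divnK // mulnC.
Qed.

Lemma moebius_inversion (f g : nat -> int) (d : nat) :
  0 < d ->
  (forall c, c %| d -> g c = (\sum_(b <- divisors c) f b)%R) ->
  (f d = \sum_(c <- divisors d) moebius (d %/ c) * g c)%R.
Proof.
move=> d_gt0 gE.
transitivity (\sum_(c <- divisors d) \sum_(b <- divisors d | (b %| c)%N)
                moebius (d %/ c) * f b)%R; last first.
  apply: eq_big_seq => c; rewrite -dvdn_divisors // => c_d.
  rewrite gE // GRing.mulr_sumr -big_filter; apply: perm_big.
  have c_gt0 := dvdn_gt0 d_gt0 c_d.
  apply: uniq_perm; rewrite ?filter_uniq ?divisors_uniq // => b.
  rewrite mem_filter -!dvdn_divisors //.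
  by apply: andb_idr => /dvdn_trans; apply.
(* After the exchange the coefficient of [f b] is the sum of [moebius] over the divisors of
   [d %/ b], which vanishes unless [b = d]. *)
rewrite (exchange_big_dep xpredT) //=.
rewrite (bigD1_seq d) ?divisors_uniq -?dvdn_divisors //=.
have inner b : b %| d ->
  (\sum_(c <- divisors d | (b %| c)%N) moebius (d %/ c) * f b
     = (b == d)%:R * f b)%R.
  move=> b_d; have b_gt0 := dvdn_gt0 d_gt0 b_d.
  rewrite -GRing.mulr_suml; congr (_ * _)%R.
  rewrite -big_filter -(big_map (fun c => d %/ c) xpredT) /=.
  rewrite (perm_big _ (perm_codivisors d_gt0 b_d)).
  rewrite sum_moebius_divisors; last by rewrite divn_gt0 // dvdn_leq.
  by rewrite -(eqn_pmul2r b_gt0) divnK // mul1n eq_sym.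
rewrite inner // eqxx GRing.mul1r big_seq_cond big1 ?GRing.addr0 // => b.
rewrite -dvdn_divisors // => /andP[b_d /negPf bNd].
by rewrite inner // bNd GRing.mul0r.
Qed.

(** * Counting solutions of x ^+ c = 1 *)

Lemma card_orders_in (gT : finGroupType) (G : {set gT}) (s : seq nat) :
  uniq s -> #|[set x in G | #[x]%g \in s]| = \sum_(d <- s) num_order G d.
Proof.
move=> s_uniq; rewrite /num_order.
under eq_bigr => d _ do rewrite cardsE -sum1_card.
under eq_bigr => d _ do rewrite big_mkcond.
rewrite exchange_big cardsE -sum1_card big_mkcond /=; apply: eq_bigr => x _.
rewrite unfold_in /=; case xG: (x \in G) => /=; last first.
  by rewrite big1 // => d _; rewrite unfold_in /= xG.
under eq_bigr => d _ do rewrite unfold_in /= xG /=.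
rewrite -big_mkcond /= sum1_count.
by rewrite (eq_count (a2 := pred1 #[x]%g)) ?count_uniq_mem.
Qed.

Lemma card_Ldiv_num_order (gT : finGroupType) (G : {set gT}) (c : nat) :
  0 < c -> #|'Ldiv_c(G)%g| = \sum_(b <- divisors c) num_order G b.
Proof.
move=> c_gt0; rewrite -card_orders_in ?divisors_uniq //; congr #|pred_of_set _|.
by apply/setP=> x; rewrite !inE -dvdn_divisors // order_dvdn.
Qed.

(** The solutions form the subgroup of order [gcdn c #|H|], because in a cyclic
    group inclusion of subgroups amounts to divisibility of their orders. *)
Lemma card_Ldiv_cyclic (gT : finGroupType) (H : {group gT}) (c : nat) :
  cyclic H -> #|'Ldiv_c(H)%g| = gcdn c #|H|.
Proof.
case/cyclicP=> a ->; rewrite -/#[a]%g; set g := gcdn c _.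
have g_a : g %| #[a]%g := dvdn_gcdr _ _.
have g_gt0 : 0 < g := dvdn_gt0 (order_gt0 a) g_a.
have oK : #[a ^+ (#[a] %/ g)]%g = g.
  by rewrite orderXdiv ?dvdn_div // divnA // mulKn ?order_gt0.
rewrite -[RHS]oK; congr #|pred_of_set _|; apply/setP=> x.
rewrite !inE -order_dvdn; apply/andP/idP=> [[x_a x_c]|x_K].
  rewrite -cycle_subG.
  rewrite -(cardSg_cyclic (cycle_cyclic a)) ?cycle_subG ?mem_cycle //.
  by rewrite -!orderE oK dvdn_gcd x_c order_dvdG.
split; first by apply: subsetP x_K; rewrite cycle_subG mem_cycle.
apply: dvdn_trans (dvdn_gcdl c #[a]%g); rewrite -/g -oK.
exact: order_dvdG.
Qed.

Lemma card_Ldiv_isog {aT rT : finGroupType} {G : {group aT}} {H : {group rT}}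
    {c : nat} :
  (G \isog H)%g -> #|'Ldiv_c(G)%g| = #|'Ldiv_c(H)%g|.
Proof.
case/isogP=> f injf <-; rewrite -(card_injm injf) ?subsetIl //.
congr #|pred_of_set _|; apply/setP=> y; apply/morphimP/idP.
  case=> x xG; rewrite !inE xG /= => /eqP xc ->.
  by rewrite mem_morphim //= -morphX // xc morph1.
rewrite !inE => /andP[/morphimP[x xG _ ->]]; rewrite -order_dvdn order_injm //.
by rewrite order_dvdn => xc; exists x => //; rewrite !inE xG.
Qed.

Lemma cyclic_Zp (m : nat) : cyclic (Zp m).
Proof.
rewrite /Zp; case: ifP => _; last exact: cyclic1.
by apply/cyclicP; exists Zp1; rewrite -Zp_cycle.
Qed.

Lemma card_Ldiv_cyclic_sum (r : nat) (n : 'I_r -> nat) (c : nat) :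
  (forall i, 0 < n i) ->
  #|'Ldiv_c(cyclic_sum n)%g| = \prod_(i < r) gcdn c (n i).
Proof.
move=> n_gt0.
have -> : 'Ldiv_c(cyclic_sum n)%g = setXn (fun i => 'Ldiv_c(Zp (n i))%g).
  have expE (x : {dffun forall i : 'I_r, 'Z_(n i)}) i :
      (x ^+ c)%g i = (x i ^+ c)%g.
    by elim: c => [|c IHc]; rewrite ?expg0 ?expgS ffunE ?IHc.
  apply/setP=> x; rewrite in_setI [X in _ && X]inE.
  apply/andP/setXnP=> [[xZ /eqP xc] i|xZc].
    by move/setXnP/(_ i): xZ => xZi; rewrite in_setI xZi inE -expE xc ffunE /=.
  split; first by apply/setXnP=> i; have:= xZc i; rewrite inE => /andP[].
  apply/eqP/ffunP=> i; have:= xZc i; rewrite expE !inE ffunE.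
  by case/andP=> _ /eqP.
rewrite cardsXn; apply: eq_bigr => i _.
by rewrite card_Ldiv_cyclic ?card_Zp ?cyclic_Zp.
Qed.

(** * Exponent and Chowla number *)

(** The exponent divides [c] iff the solutions of [x ^+ c = 1] exhaust [G], i.e.
    iff [\prod_i gcdn c (n i)] reaches [\prod_i n i]; one strict inequality
    between positive factors makes the products differ. *)
Lemma exponent_dvdn_cyclic_sum {gT : finGroupType} {G : {group gT}}
    {r : nat} {n : 'I_r -> nat} {c : nat} :
  (forall i, 0 < n i) -> (G \isog cyclic_sum n)%g ->
  (exponent G %| c) = [forall i, n i %| c].
Proof.
move=> n_gt0 isoG.
have cardE k : #|'Ldiv_k(G)%g| = \prod_i gcdn k (n i).
  by rewrite (card_Ldiv_isog isoG) card_Ldiv_cyclic_sum.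
have cardG : #|G| = \prod_i n i.
  rewrite (card_isog isoG) cardsXn; apply: eq_bigr => i _; exact: card_Zp.
have -> : (exponent G %| c) = (#|G| <= #|'Ldiv_c(G)%g|).
  rewrite -sub_Ldiv (geq_leqif (subset_leqif_cards (subsetIl G _))).
  by rewrite eqEsubset subsetIl.
rewrite cardG cardE; apply/idP/forallP => [le_prod i|n_c]; last first.
  by apply: leq_prod => i _; rewrite (gcdn_idPr (n_c i)).
apply: contraLR le_prod => /negP nNc; rewrite -ltnNge.
rewrite (bigD1 i) //= [X in _ < X](bigD1 i) //=.
apply: (@leq_ltn_trans (gcdn c (n i) * \prod_(j < r | j != i) n j)).
  by rewrite leq_mul2l leq_prod ?orbT // => j _; rewrite dvdn_leq ?dvdn_gcdr.
rewrite ltn_pmul2r ?prodn_gt0 // ltn_neqAle dvdn_leq ?dvdn_gcdr // andbT.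
by apply/eqP=> /gcdn_idPr.
Qed.

(** The sum counts the elements of order greater than [m]. A largest Chowla set
    consists of such elements for [m] its own size; conversely, if [k > 0] and
    at least [k] elements have order greater than [k], any [k] of them form a
    Chowla set. *)
Lemma chowla_number_maximum (gT : finGroupType) (G : {group gT}) :
  is_maximum
    (fun m : nat => m <= \sum_(d <- divisors (exponent G) | m < d) num_order G d)
    (chowla_number G).
Proof.
have sumE m : \sum_(d <- divisors (exponent G) | m < d) num_order G d
    = #|[set x in G | m < #[x]%g]|.
  rewrite -big_filter -card_orders_in ?filter_uniq ?divisors_uniq //.
  congr #|pred_of_set _|; apply/setP=> x; rewrite !inE.
  case xG: (x \in G) => //=.
  by rewrite mem_filter -dvdn_divisors ?exponent_gt0 // dvdn_exponent // andbT.
split=> [|k]; rewrite sumE.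
  (* Without Chowla sets the number is 0 and the bound is trivial. *)
  have [S0 chowla_S0|no_chowla] := pickP (chowla_set G); last first.
    by have -> : chowla_number G = 0 by exact: big_pred0.
  have [|S] := @eq_bigmax_cond _ (chowla_set G) (fun S => #|S|).
    by apply/card_gt0P; exists S0.
  move=> /and3P[_ /subsetP S_G /forall_inP S_ord] defS.
  have -> : chowla_number G = #|S| := defS.
  apply/subset_leq_card/subsetP=> x xS.
  by rewrite inE S_G //= S_ord.
(* The empty set is not a Chowla set, so [k = 0] is treated apart. *)
case: k => // k /card_geqP[s [s_uniq size_s s_ord]].
have card_s : #|[set x in s]| = k.+1 by rewrite cardsE (card_uniqP s_uniq).
rewrite -card_s; apply: (@leq_bigmax_cond _ (chowla_set G)).
apply/and3P; split; first by rewrite -card_gt0 card_s.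
  by apply/subsetP=> x; rewrite inE => /s_ord; rewrite inE => /andP[].
by apply/forall_inP=> x; rewrite card_s inE => /s_ord; rewrite inE => /andP[].
Qed.

Theorem theorem3p2 (gT : finGroupType) (G : {group gT})
    (r : nat) (n : 'I_r.+1 -> nat)
    (n_gt0 : forall i : 'I_r.+1, 0 < n i)
    (n_dvd : forall i j : 'I_r.+1, j = i.+1 :> nat -> n i %| n j)
    (isoG : (G \isog cyclic_sum n)%g)
    (ntG : 1 < #|G|) :
  let e := exponent G in
  [/\ e = n ord_max,
      forall d : nat, d %| e ->
        (num_order G d)%:Z%R =
          (\sum_(c <- divisors d)
             moebius (d %/ c) * (\prod_(i < r.+1) gcdn c (n i))%N%:Z)%R
    & is_maximum
        (fun m : nat => m <= \sum_(d <- divisors e | m < d) num_order G d)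
        (chowla_number G)].
Proof.
have n_last i : n i %| n ord_max.
  have chain m : forall j k : 'I_r.+1, k = j + m :> nat -> n j %| n k.
    elim: m => [|m IHm] j k def_k.
      by rewrite (_ : k = j) //; apply: val_inj; rewrite /= def_k addn0.
    have lt_jm : j + m < r.+1 by rewrite ltnW // -addnS -def_k.
    apply: dvdn_trans (IHm j (Ordinal lt_jm) erefl) _.
    by apply: n_dvd; rewrite def_k addnS.
  by apply: (chain (r - i)); rewrite /= subnKC // -ltnS.
move=> e; split; last exact: chowla_number_maximum.
  apply/eqP; rewrite eqn_dvd (exponent_dvdn_cyclic_sum n_gt0 isoG).
  apply/andP; split; first exact/forallP.
  have:= dvdnn e.
  by rewrite {1}/e (exponent_dvdn_cyclic_sum n_gt0 isoG) => /forallP.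
move=> d d_e; have d_gt0 := dvdn_gt0 (exponent_gt0 G) d_e.
apply: (moebius_inversion (fun b => (num_order G b)%:Z%R)) => // c c_d.
have c_gt0 := dvdn_gt0 d_gt0 c_d.
rewrite -card_Ldiv_cyclic_sum // -(card_Ldiv_isog isoG).
by rewrite card_Ldiv_num_order // (big_morph Posz PoszD erefl).
Qed.
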